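(* Let $\nu\ge 1$ be an integer, $N>0$, $u>0$, and consider the monic orthogonal polynomials $\{\mathcal P_n(z;u)\}_{n\ge0}$ on $\mathbb R$ with respect to the weight $e^{-N\mathscr V(z;u)}$, $\mathscr V(z;u)=\frac{z^2}{2}+u\frac{z^{2\nu}}{2\nu}$, with three-term recurrence $z\mathcal P_n(z)=\mathcal P_{n+1}(z)+\mathcal R_n\mathcal P_{n-1}(z)$. Let $x=n/N$ and let $\mathcal R_n(x;u)\sim\sum_{g=0}^\infty r_{2g}(x;u)N^{-2g}$ ($N\to\infty$) be the topological expansion of the recurrence coefficients, where each $r_{2g}(x;u)$ is analytic near $(x,u)=(1,0)$. Write $r_{2g}(x;u)=\sum_{j=0}^\infty \beta_{2g,j}(x)u^j$. Then for all $g,j\ge 0$, $\beta_{2g,j}(x)=c_{2g,j}\,x^{\mathscr D}$ for some constant $c_{2g,j}$, where $\mathscr D=j(\nu-1)+1-2g$. Moreover, if $\mathscr D<0$ then $\beta_{2g,j}(x)=c_{2g,j}=0$.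
   Context: The existence of the topological expansion $\mathcal R_n\sim\sum_g r_{2g}(x;u)N^{-2g}$, valid for $x$ in a neighborhood of $1$ and $u$ small, with $r_{2g}$ analytic in a neighborhood of $(1,0)$, is taken as known. Here $\mathcal R_n=\mathcal h_n/\mathcal h_{n-1}$ with $\int_{\mathbb R}\mathcal P_n\mathcal P_m e^{-N\mathscr V}\,dz=\mathcal h_n\delta_{nm}$. *)

(* Defs.v *)
From HB Require Import structures.
From mathcomp Require Import all_boot all_order all_algebra.
From mathcomp Require Import all_classical all_reals all_analysis.

Set Implicit Arguments.
Unset Strict Implicit.
Unset Printing Implicit Defensive.

Import Order.TTheory GRing.Theory Num.Theory.
Import numFieldNormedType.Exports.
Local Open Scope classical_set_scope.
Local Open Scope ring_scope.

Definition potential (R : realType) (nu : nat) (u z : R) : R :=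
  z ^+ 2 / 2 + u * (z ^+ (2 * nu) / (2 * nu)%:R).

Definition weight (R : realType) (nu : nat) (N u z : R) : R :=
  expR (- (N * potential nu u z)).

Definition monic_orthogonal (R : realType) (w : R -> R)
    (P : nat -> {poly R}) (h : nat -> R) : Prop :=
  (forall n, P n \is monic /\ size (P n) = n.+1) /\
  (forall n m,
     (\int[lebesgue_measure]_z ((P n).[z] * (P m).[z] * w z)%:E
      = (if n == m then h n else 0)%:E)%E).

(* The case n = 0 follows the convention P_{-1} = 0; the value a 0 is unused. *)
Definition three_term_recurrence (R : realType)
    (P : nat -> {poly R}) (a : nat -> R) : Prop :=
  'X * P 0%N = P 1%N /\
  (forall n : nat, (0 < n)%N -> 'X * P n = P n.+1 + a n *: P n.-1).

(* rr g stands for r_{2g}.  This is the asymptotic expansion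
   Rc N u n ~ \sum_g r_{2g}(x; u) N^{-2g} as N -> +oo with x = n / N, uniform
   for x near 1 and small u > 0; both the neighborhood and the constants may
   depend on the order G of truncation. *)
Definition topological_expansion (R : realType)
    (Rc : R -> R -> nat -> R) (rr : nat -> R -> R -> R) : Prop :=
  forall G : nat, exists eta C N0 : R, [/\ 0 < eta, 0 < N0 &
    forall (N u : R) (n : nat),
      N0 < N -> (0 < n)%N -> `|n%:R / N - 1| < eta -> 0 < u < eta ->
      `|Rc N u n - \sum_(g < G) rr g (n%:R / N) u * N ^- (2 * g)|
        <= C * N ^- (2 * G)].

Definition double_psum (R : realType) (a : nat -> nat -> R) (s t : R) : R^nat :=
  fun n => \sum_(k < n) \sum_(l < n) a k l * s ^+ k * t ^+ l.

(* f is, on the box of half-side d around (x0, u0), the sum of an absolutely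
   convergent double power series centered at (x0, u0). *)
Definition analytic_on_box (R : realType) (f : R -> R -> R) (x0 u0 d : R) :
    Prop :=
  exists a : nat -> nat -> R, forall x u : R,
    `|x - x0| < d -> `|u - u0| < d ->
    cvgn (double_psum (fun k l => `|a k l|) `|x - x0| `|u - u0|) /\
    double_psum a (x - x0) (u - u0) @ \oo --> f x u.

Definition scaling_exponent (nu g j : nat) : int :=
  j%:Z * (nu%:Z - 1) + 1 - 2 * g%:Z.

(* Main.v *)
Require Import Defs.
From HB Require Import structures.
From mathcomp Require Import all_boot all_order all_algebra.
From mathcomp Require Import all_classical all_reals all_analysis.
From mathcomp Require Import measurable_realfun.
From mathcomp Require Import ring lra zify.

Set Implicit Arguments.
Unset Strict Implicit.
Unset Printing Implicit Defensive.

Import Order.TTheory GRing.Theory Num.Theory.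
Import numFieldNormedType.Exports.
Local Open Scope classical_set_scope.
Local Open Scope ring_scope.

(** Integrating [(P_n P_(n-1) e^(-NV))'] over the line gives the string equation
    [n/N = R_n + u * S_n], where [S_n] is a sum, over lattice paths with [nu-1]
    up-steps and [nu] down-steps, of products of [nu] neighbouring recurrence
    coefficients.  Iterating [R_n = n/N - u * S_n] from [0] produces polynomials
    [Q_J(x,e,u)], spanned by monomials [u^j e^a x^b] with
    [a + b = j (nu-1) + 1], and since the [R_n] are bounded (truncation order 0
    of the expansion) each iteration gains a factor [u]:
    [R_n = Q_J(n/N, 1/N, u) + O(u^J)] uniformly near [x = 1].  Comparing with
    the topological expansion at fixed [x] identifies [beta_(2g,j)(x)] with the
    coefficient of [u^j e^(2g)] in [Q_J], that is [c x^(j (nu-1) + 1 - 2g)], or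
    [0] when the exponent would be negative.  This holds near [x = 1] and
    extends to the whole box because [beta_(2g,j)] is a power series there. *)

(** * Polynomial moments of an exponential weight *)

Section ExpPolyWeight.
Variables (R : realType) (q : {poly R}) (a : R).
Hypotheses (a_gt0 : 0 < a) (q_le : forall z, q.[z] <= - (a * z ^+ 2)).
Let mu := @lebesgue_measure R.

(** Induction on [p], with the rate [b] left free: half of the Gaussian serves the induction
    hypothesis, and the other half absorbs the new factor [z], since [|z| * e^(-b z^2 / 2)] is at
    most [1 + 2 / b]. *)
Lemma horner_gauss_bounded (p : {poly R}) (b : R) : 0 < b ->
  exists2 C : R, 0 <= C & forall z, `|p.[z]| * expR (- (b * z ^+ 2)) <= C.
Proof.
elim/poly_ind: p b => [|p c IHp] b b0.
  by exists 0 => // z; rewrite horner0 normr0 mul0r.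
have b2 : 0 < b / 2 by rewrite divr_gt0.
have [C C0 HC] := IHp _ b2.
exists (C * (1 + (b / 2)^-1) + `|c|).
  by rewrite addr_ge0 // mulr_ge0 // addr_ge0 // invr_ge0 ltW.
move=> z; rewrite hornerMXaddC.
have -> : - (b * z ^+ 2) = - (b / 2 * z ^+ 2) + - (b / 2 * z ^+ 2) by field.
rewrite expRD; set e := expR _.
have e0 : 0 < e by apply: expR_gt0.
have e1 : e <= 1 by rewrite /e expR_le1 oppr_le0 mulr_ge0 ?sqr_ge0 // ltW.
have ez : `|z| * e <= 1 + (b / 2)^-1.
  have : 1 + b / 2 * z ^+ 2 <= e^-1 by rewrite /e expRN invrK expR_ge1Dx.
  rewrite -(ler_pM2r e0) mulVf ?gt_eqF // => h.
  have h2 : e * z ^+ 2 <= (b / 2)^-1.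
    by rewrite -[leRHS]mul1r ler_pdivlMr // (le_trans _ h) //; nra.
  have h3 : `|z| <= 1 + z ^+ 2.
    by rewrite -[z ^+ 2]real_normK ?num_real //; have := sqr_ge0 (`|z| - 1); nra.
  apply: (le_trans (ler_wpM2r (ltW e0) h3)); nra.
apply: (@le_trans _ _ ((`|p.[z]| * e) * (`|z| * e) + `|c| * (e * e))).
  have := ler_normD (p.[z] * z) c; rewrite normrM => h.
  have ee : 0 <= e * e by rewrite mulr_ge0 // ltW.
  apply: (le_trans (ler_wpM2r ee h)); lra.
apply: lerD; last by rewrite ler_piMr // mulr_ile1 // ltW.
by apply: ler_pM => //; rewrite mulr_ge0 // ltW.
Qed.

Lemma continuous_horner_expR (p : {poly R}) :
  continuous (fun z : R => p.[z] * expR q.[z]).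
Proof.
move=> z; apply: cvgM; first exact: continuous_horner.
by apply: continuous_comp; [exact: continuous_horner|exact: continuous_expR].
Qed.

(** One half of the decay [e^(-a z^2)] bounds [p]; the other half is a multiple of the normal
    density of variance [1 / a], which is integrable. *)
Lemma integrable_horner_expR (p : {poly R}) :
  mu.-integrable setT (fun z => (p.[z] * expR q.[z])%:E).
Proof.
pose s := Num.sqrt a^-1.
have s0 : s != 0 by rewrite sqrtr_eq0 -ltNge invr_gt0.
have s2 : s ^+ 2 = a^-1 by rewrite sqr_sqrtr // invr_ge0 ltW.
have pk := normal_peak_gt0 s0.
have a2 : 0 < a / 2 by rewrite divr_gt0.
have [C C0 HC] := horner_gauss_bounded p a2.
have ig : mu.-integrable setT
    (fun z => ((C / normal_peak s)%:E * (normal_pdf 0 s z)%:E)%E).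
  by apply: integrableZl => //; exact: integrable_normal_pdf.
apply: (le_integrable measurableT _ _ ig).
- apply/measurable_EFinP; apply: continuous_measurable_fun.
  exact: continuous_horner_expR.
- move=> z _ /=; rewrite lee_fin normal_pdfE // mulrA divfK ?gt_eqF //.
  rewrite /normal_fun subr0 s2 normrM (ger0_norm (expR_ge0 _)).
  rewrite [leRHS]ger0_norm ?mulr_ge0 ?expR_ge0 //.
  have -> : - z ^+ 2 / (a^-1 *+ 2) = - (a / 2 * z ^+ 2).
    by field; rewrite gt_eqF.
  apply: (@le_trans _ _ (`|p.[z]| * (expR (- (a / 2 * z ^+ 2)) *
      expR (- (a / 2 * z ^+ 2))))).
    rewrite ler_wpM2l // -expRD ler_expR (le_trans (q_le z)) //.
    by lra.
  by rewrite mulrA ler_wpM2r ?expR_ge0.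
Qed.

(** Real-valued, so that it can serve as a linear functional on polynomials; [wintE] links it to the
    extended-real integral. *)
Definition wint (p : {poly R}) : R := \int[mu]_z (p.[z] * expR q.[z]).

Lemma wintE (p : {poly R}) :
  (\int[mu]_z (p.[z] * expR q.[z])%:E)%E = (wint p)%:E.
Proof.
rewrite /wint /Rintegral fineK //.
exact: (integrable_fin_num measurableT (integrable_horner_expR p)).
Qed.

Lemma wintD (p1 p2 : {poly R}) : wint (p1 + p2) = wint p1 + wint p2.
Proof.
rewrite /wint -RintegralD //; try exact: integrable_horner_expR.
by apply: eq_Rintegral => z _; rewrite hornerD mulrDl.
Qed.

Lemma wintZ c (p : {poly R}) : wint (c *: p) = c * wint p.
Proof.
rewrite /wint -RintegralZl //; last exact: integrable_horner_expR.
by apply: eq_Rintegral => z _; rewrite hornerZ mulrA.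
Qed.

(** If the integral vanished, [p^2 e^q] would be zero almost everywhere; but a monic polynomial is
    positive beyond its Cauchy bound [b], in particular on [[b, b + 1]], which has measure 1. *)
Lemma wint_sqr_gt0 (p : {poly R}) : p \is monic -> 0 < wint (p * p).
Proof.
move=> pm; rewrite lt_neqAle andbC; apply/andP; split.
  by apply: Rintegral_ge0 => z _; rewrite hornerM mulr_ge0 ?expR_ge0 // -expr2 sqr_ge0.
apply/eqP => w0.
have mf : measurable_fun setT (fun z => ((p * p).[z] * expR q.[z])%:E).
  apply/measurable_EFinP; apply: continuous_measurable_fun.
  exact: continuous_horner_expR.
have : (\int[mu]_z `|((p * p).[z] * expR q.[z])%:E|)%E = 0%E.
  transitivity (wint (p * p))%:E; last by rewrite -w0.
  rewrite -wintE; apply: eq_integral => z _.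
  by rewrite gee0_abs // lee_fin hornerM mulr_ge0 ?expR_ge0 // -expr2 sqr_ge0.
move/(ae_eq_integral_abs mu measurableT mf) => [A [mA A0 subA]].
have [b Hb] := monic_Cauchy_bound pm.
have : (mu `[b, (b + 1)%R] <= 0)%E.
  rewrite -A0; apply: le_measure; rewrite ?inE // => z /=; rewrite in_itv /= => /andP[bz _].
  apply: subA => /= /(_ I) [] /eqP; rewrite mulf_eq0 hornerM mulf_eq0 expR_eq0.
  by rewrite gt_eqF ?Hb.
by rewrite /mu lebesgue_measure_itv /= lte_fin ltrDl ltr01 -EFinD addrC addKr lee_fin ler10.
Qed.

(** The integrand is the derivative of [F = p e^q]. Its integrals over growing symmetric intervals
    converge to the full integral by domination, and to 0 because the boundary values of [F]
    decay. *)
Lemma wint_by_parts (p : {poly R}) : wint (p^`() + q^`() * p) = 0.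
Proof.
pose F z := p.[z] * expR q.[z].
pose f z := (p^`() + q^`() * p).[z] * expR q.[z].
have dF (z : R) : is_derive z 1 F (f z).
  have h1 : is_derive z 1 (horner p) p^`().[z].
    by rewrite derivE derive1E; apply: DeriveDef => //; exact: derivable_horner.
  have h2 : is_derive z 1 (horner q) q^`().[z].
    by rewrite derivE derive1E; apply: DeriveDef => //; exact: derivable_horner.
  have h3 : is_derive z 1 (expR \o horner q) (q^`().[z] * expR q.[z]).
    rewrite mulrC; apply: is_derive1_comp.
  have -> : F = horner p * (expR \o horner q) by exact/funext.
  apply: is_derive_eq (is_deriveM h1 h3) _.
  by rewrite /f hornerD hornerM /GRing.scale /=; ring.
have cf : continuous f by exact: continuous_horner_expR.
have FTC n : (\int[mu]_(z in `[(- n.+1%:R)%R, n.+1%:R%R]) (f z)%:E =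
    (F n.+1%:R%R)%:E - (F (- n.+1%:R)%R)%:E)%E.
  apply: continuous_FTC2.
  - by rewrite gtrN.
  - exact: continuous_subspaceT.
  - split.
    + by move=> z _; have [] := dF z.
    + apply: cvg_at_right_filter; apply: differentiable_continuous.
      by apply/derivable1_diffP; have [] := dF (- n.+1%:R).
    + apply: cvg_at_left_filter; apply: differentiable_continuous.
      by apply/derivable1_diffP; have [] := dF (n.+1%:R).
  - by move=> z _; rewrite derive1E; have [] := dF z.
(* The extra factor ['X] turns boundedness into the decay [|F z| <= C / |z|]. *)
have [C C0 HC] := horner_gauss_bounded ('X * p) a_gt0.
have FC z : `|F z| * `|z| <= C.
  apply: le_trans (HC z); rewrite /F normrM (ger0_norm (expR_ge0 _)).
  rewrite mulrAC hornerM hornerX normrM [`|z| * _]mulrC.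
  apply: ler_wpM2l; first by rewrite mulr_ge0.
  by rewrite ler_expR q_le.
pose In n : set R := [set` `[- n.+1%:R : R, n.+1%:R]].
have mIn n : measurable (In n) by exact: measurable_itv.
have mf : measurable_fun setT (EFin \o f).
  by apply/measurable_EFinP; exact: continuous_measurable_fun.
have cvgI : (\int[mu]_(z in In n) (f z)%:E)%E @[n --> \oo] -->
    (\int[mu]_z (f z)%:E)%E.
  under eq_fun do rewrite integral_mkcond.
  have ig := integrable_abse (integrable_horner_expR (p^`() + q^`() * p)).
  have := @dominated_convergence _ _ _ mu setT measurableT
    (fun n => (EFin \o f) \_ (In n)) (EFin \o f) _ _ mf _ ig.
  case => //.
  - move=> n; apply/(measurable_restrictT _ (mIn n)).
    exact: measurable_funS mf.
  - apply: aeW => z _; apply: cvg_near_cst; near=> n.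
    rewrite patchE ifT // inE /In /= in_itv /= -ler_norml.
    apply: (@le_trans _ _ n%:R); last by rewrite ler_nat.
    near: n; exact: nbhs_infty_ger.
  - apply: aeW => z n _; rewrite patchE; case: ifP => // _.
    by rewrite abse0 abse_ge0.
have cvg0 : (\int[mu]_(z in In n) (f z)%:E)%E @[n --> \oo] --> 0%:E.
  under eq_fun do rewrite FTC -EFinB.
  apply: cvg_EFin; first by near=> n.
  apply/cvgr0Pnorm_le => e e0; near=> n => /=.
  have n0 : 0 < n.+1%:R :> R by rewrite ltr0n.
  apply: (@le_trans _ _ (2 * C / n.+1%:R)).
    rewrite (le_trans (ler_normB _ _)) // ler_pdivlMr // mulrDl.
    have := FC n.+1%:R; have := FC (- n.+1%:R).
    by rewrite normrN (ger0_norm (ltW n0)); lra.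
  rewrite ler_pdivrMr // -ler_pdivrMl //.
  apply: (@le_trans _ _ n%:R); last by rewrite ler_nat.
  near: n; exact: nbhs_infty_ger.
by apply: EFin_inj; rewrite -wintE; exact: (cvg_unique _ cvgI cvg0).
Unshelve. all: by end_near.
Qed.
End ExpPolyWeight.

(** * String equation *)

(* Weighted count of the lattice paths starting at site [i] with [k] steps, [d]
   of them downwards; a down-step from site [i] has weight [F i].  Sites are
   natural numbers, so [i.-1] is only meaningful for paths with [k <= i]. *)
Fixpoint path_sum (R : pzRingType) (F : nat -> R) (k d i : nat) : R :=
  if k is k'.+1 then
    path_sum F k' d i.+1 + (if d is d'.+1 then F i * path_sum F k' d' i.-1 else 0)
  else (d == 0%N)%:R.

(** With [k <= i] no down-step is taken from site 0, where the truncated predecessor would not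
    commute with the shift. *)
Lemma path_sum_shift (R : pzRingType) (F : nat -> R) m k d i : (k <= i)%N ->
  path_sum F k d (m + i) = path_sum (fun i => F (m + i)%N) k d i.
Proof.
elim: k d i => [|k IHk] d [|i] //= ki.
rewrite -addnS IHk; last by lia.
by case: d => [|d] //; rewrite addnS /= IHk //; lia.
Qed.

(** * The string equation for an abstract orthogonality functional *)

Section OrthogonalPolynomials.
Variables (R : numFieldType) (L : {poly R} -> R).
Hypotheses (LD : {morph L : p1 p2 / p1 + p2})
  (LZ : forall c p, L (c *: p) = c * L p).
Variables (P : nat -> {poly R}) (h a : nat -> R).
Hypotheses (P_monic : forall n, P n \is monic)
  (size_P : forall n, size (P n) = n.+1)
  (LP : forall n m, L (P n * P m) = if n == m then h n else 0)
  (P_rec : forall n, (0 < n)%N -> 'X * P n = P n.+1 + a n *: P n.-1).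

Let L0 : L 0 = 0.
Proof. by rewrite -(scale0r 0) LZ mul0r. Qed.

Lemma coef_P_lead n : (P n)`_n = 1.
Proof. by have /monicP := P_monic n; rewrite lead_coefE size_P. Qed.

Lemma size_subP_leq n (p : {poly R}) :
  (size p <= n.+1)%N -> (size (p - p`_n *: P n)%R <= n)%N.
Proof.
move=> sp; apply/leq_sizeP => j; rewrite leq_eqVlt => /predU1P[<-|nj].
  by rewrite coefB coefZ coef_P_lead mulr1 subrr.
rewrite coefB coefZ (nth_default _ (leq_trans sp nj)).
by rewrite [(P n)`_j]nth_default ?size_P // mulr0 subrr.
Qed.

(** Subtracting a multiple of [P m] lowers the degree of [p], and each [P m] with [m < n] is
    orthogonal to [P n]. *)
Lemma orthogonal_lower n (p : {poly R}) : (size p <= n)%N -> L (P n * p) = 0.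
Proof.
suff H m : (m <= n)%N -> forall p : {poly R}, (size p <= m)%N -> L (P n * p) = 0.
  exact: H.
elim: m => [|m IHm] mn {}p sp.
  by move: sp; rewrite leqn0 size_poly_eq0 => /eqP ->; rewrite mulr0.
rewrite -[p](subrK (p`_m *: P m)) mulrDr LD IHm ?size_subP_leq //; last exact: ltnW.
by rewrite -scalerAr LZ LP gtn_eqF // mulr0 addr0.
Qed.

(** Each factor ['X] moves [P n] up to [P n.+1], or down to [P n.-1] with weight [a n].
    Orthogonality keeps only the paths ending at [l], and the second hypothesis fixes their number
    [d] of down-steps; [k <= n] keeps the recurrence at positive indices. *)
Lemma moment_path_sum k d n l : (k <= n)%N -> (n + k = l + d.*2)%N ->
  L ('X^k * P n * P l) = path_sum a k d n * h l.
Proof.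
elim: k d n => [|k IHk] d n kn e /=.
  rewrite mul1r LP; case: d e => [|d] e; first by rewrite mul1r ifT; [congr h|]; lia.
  by rewrite mul0r ifF //; lia.
rewrite exprSr -(mulrA 'X^k) P_rec; last by lia.
rewrite mulrDr mulrDl LD (IHk d); [|lia|lia].
rewrite mulrDl; congr (_ + _).
rewrite -scalerAr -scalerAl LZ.
case: d e => [|d] e.
  (* With no down-step available, going down leaves a polynomial of degree below [l]. *)
  rewrite [_ * P l]mulrC orthogonal_lower ?mulr0 ?mul0r //.
  by rewrite mulrC size_mulXn ?size_P ?monic_neq0 //; lia.
by rewrite (IHk d) ?mulrA //; lia.
Qed.

(** The derivative of [P n] is [n P_(n-1)] plus lower degree, and that of [P n.-1] has degree below
    [n]; orthogonality removes everything else. *)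
Lemma moment_deriv n : (0 < n)%N -> L (P n * P n.-1)^`() = n%:R * h n.-1.
Proof.
case: n => // n _; rewrite derivM LD /= (orthogonal_lower (p := (P n)^`())).
  rewrite addr0; have := @size_subP_leq n (P n.+1)^`().
  rewrite coef_deriv coef_P_lead => sz.
  rewrite -[(P n.+1)^`()](subrK (n.+1%:R *: P n)) mulrDl LD mulrC orthogonal_lower.
    by rewrite add0r -scalerAl LZ LP eqxx.
  by apply: sz; have := lt_size_deriv (monic_neq0 (P_monic n.+1)); rewrite size_P.
by have := lt_size_deriv (monic_neq0 (P_monic n)); rewrite size_P; lia.
Qed.

Hypothesis h_neq0 : forall n, h n != 0.
Variables (N u : R) (nu : nat).
Hypotheses (N_neq0 : N != 0) (nu_gt0 : (0 < nu)%N).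
Hypothesis L_by_parts : forall p : {poly R},
  L p^`() = N * L (('X + u *: 'X^((2 * nu).-1)) * p).

(** Integrate [(P_n P_(n-1))'] by parts. A path from [n] to [n - 1] of length 1 is a single
    down-step, giving [a n]; one of length [2 nu - 1] has [nu] down-steps. Then cancel the common
    factor [h n.-1]. *)
Lemma string_equation n : (2 * nu <= n)%N ->
  n%:R / N = a n + u * path_sum a (2 * nu).-1 nu n.
Proof.
move=> nun; have := L_by_parts (P n * P n.-1).
rewrite moment_deriv; last by lia.
rewrite mulrDl LD -scalerAl LZ !mulrA.
rewrite -{1}['X]expr1 (moment_path_sum (d := 1)); [|lia|lia].
rewrite (moment_path_sum (d := nu)); [|lia|lia].
rewrite /= add0r mulr1 mulrA -!mulrDl mulrA => /(mulIf (h_neq0 _)) ->.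
by rewrite mulrAC divff // mul1r.
Qed.
End OrthogonalPolynomials.

(** The weight is [e^q] with [q = - N V]; since [u > 0] and the higher power is even, [q] lies below
    [- (N / 2) z^2], and the integration results apply. *)
Lemma weight_string_equation (R : realType) (nu : nat) (N u : R)
    (P : nat -> {poly R}) (h a : nat -> R) :
  (0 < nu)%N -> 0 < N -> 0 < u ->
  monic_orthogonal (weight nu N u) P h -> three_term_recurrence P a ->
  forall n, (2 * nu <= n)%N ->
  n%:R / N = a n + u * path_sum a (2 * nu).-1 nu n.
Proof.
move=> nu0 N0 u0 [Pm Po] [_ Prec].
have nuR : (2 * nu)%:R != 0 :> R by rewrite pnatr_eq0; lia.
pose V : {poly R} := 2^-1 *: 'X^2 + (u / (2 * nu)%:R) *: 'X^(2 * nu).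
pose q : {poly R} := - N *: V.
have qw z : expR q.[z] = weight nu N u z.
  rewrite /weight /potential /q /V hornerZ hornerD !hornerZ !hornerXn.
  by rewrite mulNr [2^-1 * _]mulrC -[u / _ * _]mulrA [_^-1 * z ^+ (2 * nu)]mulrC.
have aN : 0 < N / 2 by rewrite divr_gt0.
have q_le z : q.[z] <= - (N / 2 * z ^+ 2).
  rewrite /q /V hornerZ hornerD !hornerZ !hornerXn.
  have z0 : 0 <= z ^+ (2 * nu) by rewrite mulnC exprM sqr_ge0.
  have : 0 <= N * (u / (2 * nu)%:R * z ^+ (2 * nu)).
    by rewrite !mulr_ge0 ?invr_ge0 ?ler0n // ltW.
  by lra.
have LP n m : wint q (P n * P m) = if n == m then h n else 0.
  apply: EFin_inj; rewrite -(wintE aN q_le) -Po; apply: eq_integral => z _.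
  by rewrite hornerM qw.
apply: (@string_equation _ (wint q) (wintD aN q_le) (wintZ aN q_le) P h) => //.
- by move=> n; case: (Pm n).
- by move=> n; case: (Pm n).
- move=> n; have [Pn _] := Pm n.
  by have := wint_sqr_gt0 aN q_le Pn; rewrite LP eqxx => /lt0r_neq0.
- by rewrite gt_eqF.
- move=> p; have := wint_by_parts aN q_le p.
  rewrite (wintD aN q_le) => /eqP; rewrite addr_eq0 => /eqP ->.
  have -> : q^`() = - N *: ('X + u *: 'X^((2 * nu).-1)).
    rewrite /q /V derivZ derivD !derivZ !derivXn; congr (_ *: _).
    rewrite -[X in _ *: X + _]scaler_nat -[X in _ + _ *: X]scaler_nat !scalerA.
    by rewrite mulVf ?pnatr_eq0 // scale1r divfK.
  by rewrite -scalerAl (wintZ aN q_le) mulNr opprK.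
Qed.

(** * Iterating the string equation *)

Section PathSumEstimates.
Variable R : realDomainType.
Implicit Types F G : nat -> R.

(** Each step contributes at most a factor [1 + B]: weight 1 upwards and at most [B] downwards.
    Sites above [i + k] are never reached. *)
Lemma path_sum_norm_le F (M : nat) (B : R) k d i : 0 <= B ->
  (forall j, (j <= M)%N -> `|F j| <= B) -> (i + k <= M)%N ->
  `|path_sum F k d i| <= (1 + B) ^+ k.
Proof.
move=> B0 FB; elim: k d i => [|k IHk] d i ikM /=.
  by rewrite expr0; case: (d == _); rewrite ?normr1 ?normr0.
rewrite exprS mulrDl mul1r (le_trans (ler_normD _ _)) //.
apply: lerD; first by apply: IHk; lia.
case: d => [|d]; first by rewrite normr0 mulr_ge0 // exprn_ge0 // addr_ge0.
by rewrite normrM ler_pM // ?FB ?IHk //; lia.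
Qed.

(** The two products differ by [F i * (S_F - S_G) + (F i - G i) * S_G]. The constant depends on [B]
    and [k] only, hence is uniform in the sequences. *)
Lemma path_sum_lipschitz (B : R) k : 0 <= B -> exists2 C, 0 <= C &
  forall F G (M : nat) (e : R),
  (forall j, (j <= M)%N -> `|F j| <= B) ->
  (forall j, (j <= M)%N -> `|G j| <= B) ->
  (forall j, (j <= M)%N -> `|F j - G j| <= e) ->
  forall d i, (i + k <= M)%N ->
  `|path_sum F k d i - path_sum G k d i| <= C * e.
Proof.
move=> B0; elim: k => [|k [C C0 IHk]].
  exists 0 => // F G M e _ _ _ d i _ /=.
  by rewrite subrr normr0 mul0r.
exists (C + (B * C + (1 + B) ^+ k)).
  by rewrite !(addr_ge0, mulr_ge0) // exprn_ge0 // addr_ge0.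
move=> F G M e FB GB FG d i ikM /=.
have e0 : 0 <= e by apply: le_trans (FG 0%N _).
have IH := IHk F G M e FB GB FG.
rewrite opprD addrACA mulrDl (le_trans (ler_normD _ _)) //.
apply: lerD; first by apply: IH; lia.
case: d => [|d].
  by rewrite subr0 normr0 !(addr_ge0, mulr_ge0) // exprn_ge0 // addr_ge0.
rewrite (_ : _ - _ = F i * (path_sum F k d i.-1 - path_sum G k d i.-1)
  + (F i - G i) * path_sum G k d i.-1); last by ring.
rewrite (le_trans (ler_normD _ _)) // [leRHS]mulrDl; apply: lerD; rewrite normrM.
  by rewrite -mulrA ler_pM // ?FB ?IH //; lia.
rewrite mulrC; apply: ler_pM => //; last by apply: FG; lia.
by apply: (path_sum_norm_le (M := M)) => //; lia.
Qed.
End PathSumEstimates.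

(** * Polynomials in [x], [e], [u] homogeneous for a weighted degree *)

Section WeightedHomogeneous.
Variables (R : realDomainType) (m : nat).
Implicit Types f g : R -> R -> R -> R.

(* Weights: 1 for [x] and [e], and [- m] for [u]; here [m = nu - 1]. *)
Inductive whomog (d : nat) : (R -> R -> R -> R) -> Prop :=
| whomog0 : whomog d (fun _ _ _ => 0)
| whomogS c j a b f : (a + b = j * m + d)%N -> whomog d f ->
    whomog d (fun x e u => c * u ^+ j * e ^+ a * x ^+ b + f x e u).

Lemma whomog_ext d f g : (forall x e u, f x e u = g x e u) ->
  whomog d f -> whomog d g.
Proof.
move=> fg; suff -> : g = f by [].
by apply/funext => x; apply/funext => e; apply/funext => u; rewrite fg.
Qed.

Lemma whomogD d f g : whomog d f -> whomog d g ->
  whomog d (fun x e u => f x e u + g x e u).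
Proof.
elim=> [|c j a b {}f abj _ IH] gd.
  by apply: whomog_ext gd => x e u; rewrite add0r.
by apply: whomog_ext (whomogS c abj (IH gd)) => x e u; rewrite addrA.
Qed.

Lemma whomog_monomial d c j a b : (a + b = j * m + d)%N ->
  whomog d (fun x e u => c * u ^+ j * e ^+ a * x ^+ b).
Proof.
move=> abj; apply: whomog_ext (whomogS c abj (whomog0 d)) => x e u.
by rewrite addr0.
Qed.

Lemma whomog_sum d n (f : 'I_n -> R -> R -> R -> R) :
  (forall i, whomog d (f i)) -> whomog d (fun x e u => \sum_i f i x e u).
Proof.
elim: n f => [|n IHn] f fd.
  by apply: whomog_ext (whomog0 d) => x e u; rewrite big_ord0.
apply: whomog_ext (whomogD (fd ord0) (IHn (fun i => f (lift ord0 i)) _)) => //.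
by move=> x e u; rewrite big_ord_recl.
Qed.

Lemma whomogM d1 d2 f g : whomog d1 f -> whomog d2 g ->
  whomog (d1 + d2) (fun x e u => f x e u * g x e u).
Proof.
elim=> [|c j a b {}f abj _ IH] gd.
  by apply: whomog_ext (whomog0 _) => x e u; rewrite mul0r.
have H : whomog (d1 + d2)
    (fun x e u => c * u ^+ j * e ^+ a * x ^+ b * g x e u).
  elim: gd => [|c' j' a' b' g' abj' _ IH'].
    by apply: whomog_ext (whomog0 _) => x e u; rewrite mulr0.
  have E : (a + a' + (b + b') = (j + j') * m + (d1 + d2))%N.
    by rewrite mulnDl; lia.
  apply: whomog_ext (whomogS (c * c') E IH') => x e u.
  by rewrite !exprD mulrDr; congr (_ + _); ring.
by apply: whomog_ext (whomogD H (IH gd)) => x e u; rewrite mulrDl.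
Qed.

Lemma whomogN d f : whomog d f -> whomog d (fun x e u => - f x e u).
Proof.
elim=> [|c j a b {}f abj _ IH].
  by apply: whomog_ext (whomog0 d) => x e u; rewrite oppr0.
by apply: whomog_ext (whomogS (- c) abj IH) => x e u; rewrite opprD !mulNr.
Qed.

(** The binomial expansion trades powers of [x] for powers of [e], which have the same weight. *)
Lemma whomog_shift d k f : whomog d f ->
  whomog d (fun x e u => f (x + k * e) e u).
Proof.
elim=> [|c j a b {}f abj _ IH]; first exact: whomog0.
apply: whomogD IH.
apply: (@whomog_ext _ (fun x e u => \sum_(i < b.+1)
    (c * k ^+ i *+ 'C(b, i)) * u ^+ j * e ^+ (a + i) * x ^+ (b - i))).
  move=> x e u; rewrite exprDn mulr_sumr; apply: eq_bigr => i _.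
  by rewrite exprMn exprD !mulrnAl !mulrnAr; congr (_ *+ _); ring.
apply: whomog_sum => i; apply: whomog_monomial.
by have := ltn_ord i; lia.
Qed.

Lemma whomog_mulu d f : whomog (m + d) f -> whomog d (fun x e u => u * f x e u).
Proof.
elim=> [|c j a b {}f abj _ IH].
  by apply: whomog_ext (whomog0 d) => x e u; rewrite mulr0.
have E : (a + b = j.+1 * m + d)%N by rewrite mulSn; lia.
apply: whomog_ext (whomogS c E IH) => x e u.
by rewrite exprS mulrDr; congr (_ + _); ring.
Qed.

(** A path has [d] down-steps, each contributing a factor of weight 1. *)
Lemma whomog_path_sum (F : nat -> R -> R -> R -> R) k d i :
  (forall j, whomog 1 (F j)) ->
  whomog d (fun x e u => path_sum (fun j => F j x e u) k d i).
Proof.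
move=> F1; elim: k d i => [|k IHk] d i /=.
  case: d => [|d] /=; last exact: whomog0.
  apply: whomog_ext (@whomog_monomial 0 1 0 0 0 _) => // x e u.
  by rewrite !expr0 !mulr1.
apply: whomogD; first exact: IHk.
by case: d => [|d]; [exact: whomog0|exact: (whomogM (F1 i) (IHk d _))].
Qed.

Lemma whomog_bounded d f (X : R) : whomog d f -> exists2 C, 0 <= C &
  forall x e u, `|x| <= X -> `|e| <= 1 -> `|u| <= 1 -> `|f x e u| <= C.
Proof.
elim=> [|c j a b {}f abj _ [C C0 HC]].
  by exists 0 => // *; rewrite normr0.
exists (`|c| * `|X| ^+ b + C); first by rewrite addr_ge0 // mulr_ge0 // exprn_ge0.
move=> x e u xX e1 u1; rewrite (le_trans (ler_normD _ _)) // lerD ?HC //.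
rewrite !normrM !normrX.
have -> : `|c| * `|X| ^+ b = `|c| * 1 * 1 * `|X| ^+ b by rewrite !mulr1.
rewrite !ler_pM ?mulr_ge0 ?exprn_ge0 ?exprn_ile1 //.
by rewrite lerXn2r ?nnegrE // (le_trans xX) // ler_norm.
Qed.

(** Homogeneity makes the exponents of [u] and [e] determine that of [x], so monomials merge into an
    array indexed by [j] and [a]. Every large enough size [n] is allowed, to match other sums later;
    the test on [a] guards the truncated subtraction. *)
Lemma whomog_normal_form d f : whomog d f ->
  exists (q : nat -> nat -> R) (K : nat), forall n, (K <= n)%N ->
  forall x e u, f x e u = \sum_(j < n) \sum_(a < n)
    (if (a <= j * m + d)%N then q j a * x ^+ (j * m + d - a) else 0)
      * u ^+ j * e ^+ a.
Proof.
elim=> [|c j a b {}f abj _ [q [K qK]]].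
  exists (fun _ _ => 0), 0%N => n _ x e u.
  by rewrite big1 // => j _; rewrite big1 // => a _; case: ifP; rewrite !mul0r.
exists (fun j' a' => q j' a' + (if (j' == j) && (a' == a) then c else 0)).
exists (K + j + a).+1 => n Kn x e u.
have jn : (j < n)%N by lia.
have an : (a < n)%N by lia.
rewrite (qK n); last by lia.
have -> : c * u ^+ j * e ^+ a * x ^+ b = \sum_(j' < n) \sum_(a' < n)
    (if (j' == j :> nat) && (a' == a :> nat)
     then c * u ^+ j * e ^+ a * x ^+ b else 0).
  rewrite (bigD1 (Ordinal jn)) //= [X in _ + X]big1 ?addr0; last first.
    move=> j' /negbTE; rewrite -val_eqE /= => ->; exact: big1.
  rewrite (bigD1 (Ordinal an)) //= !eqxx /= big1 ?addr0 //.
  by move=> a' /negbTE; rewrite -val_eqE /= => ->.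
rewrite -big_split /=; apply: eq_bigr => j' _.
rewrite -big_split /=; apply: eq_bigr => a' _.
case: ifP => [/andP[/eqP -> /eqP ->]|_]; last by rewrite add0r addr0.
have aj : (a <= j * m + d)%N by lia.
rewrite !aj (_ : j * m + d - a = b)%N; last by lia.
by ring.
Qed.
End WeightedHomogeneous.

(** Paths of length [2 nu - 1] from [n] stay between [n - 2 nu] and [n + 2 nu]. Setting
    [n = m + 2 nu] indexes these sites by naturals [i <= 4 nu]; they move [n / N] by at most
    [2 nu / N], which is below [eta / 2] for such [N]. *)
Lemma sites_near_one (R : realType) (nu n : nat) (eta N : R) :
  0 < eta -> eta <= 1 -> (2 * (2 * nu)%:R + 4) / eta < N ->
  `|n%:R / N - 1| < eta / 2 ->
  exists m, [/\ n = (m + 2 * nu)%N, (0 < m)%N, 1 < N & forall i,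
    (m + i)%:R / N = n%:R / N + (i%:R - (2 * nu)%:R) * N^-1 /\
    ((i <= 4 * nu)%N -> `|(m + i)%:R / N - 1| < eta)].
Proof.
have [w wE] : exists w : R, w = (2 * nu)%:R by exists (2 * nu)%:R.
have w0 : 0 <= w by rewrite wE ler0n.
rewrite -wE => eta0 eta1 HN hn.
have wN : 2 * w + 4 < N.
  by apply: le_lt_trans HN; rewrite ler_pdivlMr // ler_piMr //; lra.
have N0 : 0 < N by lra.
have N'0 : 0 < N^-1 by rewrite invr_gt0.
have wN' : (2 * w + 4) * N^-1 < eta by rewrite ltr_pdivrMr // [eta * N]mulrC -ltr_pdivrMr.
have nun : (2 * nu < n)%N.
  rewrite -(ltr_nat R) -wE; move: hn; rewrite ltr_norml => /andP[h _].
  have : 1 / 2 < n%:R / N by lra.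
  by rewrite ltr_pdivlMr //; lra.
have nE : n = (n - 2 * nu + 2 * nu)%N by rewrite subnK // ltnW.
exists (n - 2 * nu)%N; split => //; [by rewrite subn_gt0|by lra|] => i.
have siteE : (n - 2 * nu + i)%:R / N = n%:R / N + (i%:R - w) * N^-1.
  by rewrite [in RHS]nE !natrD wE -mulrDl; congr (_ * _); ring.
split=> // i4; rewrite siteE addrAC (le_lt_trans (ler_normD _ _)) //.
have i4' : i%:R <= 2 * w.
  by rewrite wE -natrM ler_nat mulnA.
have : `|(i%:R - w) * N^-1| <= w * N^-1.
  rewrite normrM (gtr0_norm N'0) (ler_wpM2r (ltW N'0)) // ler_norml.
  by have := ler0n R i; lra.
have := ltW N'0; lra.
Qed.

(** * Picard iteration of the string equation *)

Section StringApproximation.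
Variables (R : realType) (nu : nat).
Hypothesis nu_gt0 : (0 < nu)%N.

(** The polynomials [Q_J], with [e] standing for [1 / N]. Paths start at site [2 nu], which
    represents [n], so site [i] represents [n + i - 2 nu] and is evaluated at [x + (i - 2 nu) e]. *)
Fixpoint string_iter (J : nat) (x e u : R) : R :=
  if J is J'.+1 then
    x - u * path_sum
      (fun i => string_iter J' (x + (i%:R - (2 * nu)%:R) * e) e u)
      (2 * nu).-1 nu (2 * nu)
  else 0.

(** The path sum has weight [nu], and the factor [u], of weight [- (nu - 1)], brings it back to 1,
    the weight of [x]. *)
Lemma whomog_string_iter J : whomog nu.-1 1 (string_iter J).
Proof.
elim: J => [|J IHJ]; first exact: whomog0.
apply: whomogD.
  apply: whomog_ext (@whomog_monomial _ nu.-1 1 1 0 0 1 _) => // x e u.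
  by rewrite !mulr1 mul1r.
apply: whomogN; apply: whomog_mulu; rewrite addn1 prednK //.
apply: (@whomog_path_sum _ _
  (fun i x e u => string_iter J (x + (i%:R - (2 * nu)%:R) * e) e u)) => i.
exact: whomog_shift.
Qed.

Variable a : R -> R -> nat -> R.
Hypothesis a_string : forall N u n, 0 < N -> 0 < u -> (2 * nu <= n)%N ->
  n%:R / N = a N u n + u * path_sum (a N u) (2 * nu).-1 nu n.
Hypothesis a_bounded : exists eta C N0 : R, [/\ 0 < eta, 0 < N0 &
  forall (N u : R) (n : nat), N0 < N -> (0 < n)%N -> `|n%:R / N - 1| < eta ->
    0 < u < eta -> `|a N u n| <= C].

(** For [J = 0] this is boundedness. In the induction step the errors [C u^J] at neighbouring sites
    pass through the Lipschitz bound on path sums and gain the prefactor [u]; the neighborhood of 1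
    shrinks to leave room for these sites. *)
Lemma string_iter_approx J : exists eta C N0 : R, [/\ 0 < eta, 0 < N0 &
  forall (N u : R) (n : nat), N0 < N -> (0 < n)%N -> `|n%:R / N - 1| < eta ->
    0 < u < eta -> `|a N u n - string_iter J (n%:R / N) N^-1 u| <= C * u ^+ J].
Proof.
have [eta0 [C0 [N00 [eta00 N000 aC]]]] := a_bounded.
elim: J => [|J [eta [C [N0 [eta_gt0 N0_gt0 IH]]]]].
  exists eta0, C0, N00; split => // N u n HN n0 hn hu.
  by rewrite subr0 expr0 mulr1 aC.
(* The bound 2 covers all sites within distance 1 of [x = 1]. *)
have [CQ CQ0 HQ] := whomog_bounded 2 (whomog_string_iter J).
have [B BC BQ] : exists2 B, C0 <= B & CQ <= B.
  by exists (Num.max C0 CQ); rewrite le_max lexx ?orbT.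
have B0 : 0 <= B by apply: le_trans BQ.
have [K K0 HK] := path_sum_lipschitz (2 * nu).-1 B0.
have [eta1 [eta1_gt0 le_eta le_eta0 le_1]] : exists eta1 : R,
    [/\ 0 < eta1, eta1 <= eta, eta1 <= eta0 & eta1 <= 1].
  exists (Num.min eta (Num.min eta0 1)).
  by rewrite !lt_min eta_gt0 eta00 ltr01 !ge_min !lexx !orbT.
pose W : R := (2 * (2 * nu)%:R + 4) / eta1.
have W0 : 0 <= W by rewrite divr_ge0 ?ltW // addr_ge0 // mulr_ge0 // ler0n.
exists (eta1 / 2), (K * C), (N0 + N00 + W).
split; [by rewrite divr_gt0|by rewrite ltr_wpDr // addr_gt0|].
move=> N u n HN n0 hn /andP[u0 u1].
have NN0 : N0 < N by apply: le_lt_trans HN; rewrite -addrA lerDl addr_ge0 // ltW.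
have NN00 : N00 < N.
  by apply: le_lt_trans HN; rewrite addrAC lerDr addr_ge0 // ltW.
have NW : W < N by apply: le_lt_trans HN; rewrite lerDr addr_ge0 // ltW.
have [m [nE m0 N1 Hm]] := sites_near_one eta1_gt0 le_1 NW hn.
have N_gt0 : 0 < N by apply: lt_trans N1.
have uE : u < eta1 by apply: lt_le_trans u1 _; rewrite ler_pdivrMr // ler_peMr ?ltW // ltr1n.
have e1 : `|N^-1| <= 1 by rewrite gtr0_norm ?invr_gt0 // invf_le1 // ltW.
have u1' : `|u| <= 1 by rewrite gtr0_norm // ltW // (lt_le_trans uE).
have [x xE] : exists x, x = n%:R / N by eexists.
rewrite -xE in hn *.
pose F i := a N u (m + i)%N.
pose G i := string_iter J (x + (i%:R - (2 * nu)%:R) * N^-1) N^-1 u.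
have site i : (m + i)%:R / N = x + (i%:R - (2 * nu)%:R) * N^-1.
  by rewrite xE; case: (Hm i).
have near i : (i <= 4 * nu)%N -> `|(m + i)%:R / N - 1| < eta1.
  by case: (Hm i).
have m_gt0 i : (0 < m + i)%N by rewrite addn_gt0 m0.
have hu0 : 0 < u < eta by rewrite u0 (lt_le_trans uE).
have hu00 : 0 < u < eta0 by rewrite u0 (lt_le_trans uE).
have FB i : (i <= 4 * nu)%N -> `|F i| <= B.
  move=> i4; apply: le_trans BC.
  by apply: aC => //; exact: lt_le_trans (near i i4) _.
have GB i : (i <= 4 * nu)%N -> `|G i| <= B.
  move=> i4; apply: le_trans BQ; apply: HQ => //.
  rewrite -site -(subrK 1 (_ / N)) (le_trans (ler_normD _ _)) // normr1 lerD2r.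
  exact: le_trans (ltW (near i i4)) _.
have FG i : (i <= 4 * nu)%N -> `|F i - G i| <= C * u ^+ J.
  move=> i4; rewrite /F /G -site; apply: IH => //.
  exact: lt_le_trans (near i i4) _.
have le4 : (2 * nu + (2 * nu).-1 <= 4 * nu)%N.
  by rewrite -[4%N]/(2 * 2)%N -mulnA [(2 * (2 * nu))%N]mul2n -addnn leq_add2l leq_pred.
have h := HK F G _ _ FB GB FG nu (2 * nu)%N le4.
have nun : (2 * nu <= n)%N by rewrite nE leq_addl.
have := a_string N_gt0 u0 nun.
rewrite -xE [in X in path_sum _ _ _ X]nE path_sum_shift; last exact: leq_pred.
(* Replacing the leading [x] of the iterate by the string equation cancels [a N u n] and leaves
   [- u] times a difference of path sums. *)
rewrite -/F => {}xE; rewrite [string_iter _ _ _ _]/= -/G {1}xE.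
rewrite (_ : _ - _ = - (u * (path_sum F (2 * nu).-1 nu (2 * nu)
  - path_sum G (2 * nu).-1 nu (2 * nu)))); last by ring.
by rewrite normrN normrM gtr0_norm // exprS [leRHS]mulrCA ler_pM2l // -mulrA.
Qed.
End StringApproximation.

(** * Power series *)

Section PowerSeries.
Variable R : realType.
Implicit Types (a b : nat -> R) (p : {poly R}).

Lemma cvg_div_succn (x : R) : x / n.+1%:R @[n --> \oo] --> 0.
Proof.
by have := cvgM (cvg_cst x) (@cvg_harmonic R); rewrite mulr0; apply.
Qed.

Lemma div_succn_lt (x eta : R) : 0 < eta ->
  exists n1, forall n, (n1 <= n)%N -> x / n.+1%:R < eta.
Proof.
move=> eta0; exists (Num.truncn (x / eta)) => n nn.
rewrite ltr_pdivrMr ?ltr0n // mulrC -ltr_pdivrMr //.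
by apply: lt_le_trans (truncnS_gt _) _; rewrite ler_nat ltnS.
Qed.

(** The constant coefficient is the limit along the sequence, hence 0; divide by ['X] and repeat.
    Points [x / n.+1] are used because these are the values of [1 / N] compatible with a fixed ratio
    [x = n / N]. *)
Lemma poly_small_coef0 p (x C : R) (M n0 : nat) : 0 < x ->
  (forall n, (n0 <= n)%N -> `|p.[x / n.+1%:R]| <= C * (x / n.+1%:R) ^+ M) ->
  forall i, (i < M)%N -> p`_i = 0.
Proof.
move=> x0; elim/poly_ind: p M => [|p c IHp] M Hp i iM; first by rewrite coef0.
case: M Hp iM => // M Hp iM.
have e0 n : 0 < x / n.+1%:R by rewrite divr_gt0 // ltr0n.
have c0 : c = 0.
  have h1 : (p * 'X + c%:P).[x / n.+1%:R] @[n --> \oo] --> (p * 'X + c%:P).[0].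
    apply: (cvg_comp _ _ (cvg_div_succn x)); exact: continuous_horner.
  have h2 : (p * 'X + c%:P).[x / n.+1%:R] @[n --> \oo] --> 0.
    apply: norm_cvg0; apply: (@squeeze_cvgr _ _ _ _ (fun=> 0)
      (fun n => C * (x / n.+1%:R) ^+ M.+1)).
    - by near=> n; rewrite normr_ge0 Hp //; near: n; exact: nbhs_infty_ge.
    - exact: cvg_cst.
    - have : (C *: 'X^(M.+1)).[x / n.+1%:R] @[n --> \oo] --> (C *: 'X^(M.+1)).[0].
        apply: (cvg_comp _ _ (cvg_div_succn x)); exact: continuous_horner.
      rewrite hornerZ hornerXn expr0n mulr0.
      by under eq_fun do rewrite hornerZ hornerXn.
  have := cvg_unique _ h1 h2.
  by rewrite hornerMXaddC mulr0 add0r; apply.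
rewrite c0 addr0 coefMX; case: i iM => //= i iM.
apply: (IHp M) => // n nn; have := Hp n nn.
by rewrite c0 addr0 hornerMX normrM (gtr0_norm (e0 n)) exprSr mulrA ler_pM2r.
Unshelve. all: by end_near.
Qed.

(** Convergence at [r] bounds [|a j| r^j] by some [M], so for [u <= r / 2] the tail is dominated by
    a geometric series of ratio at most [1 / 2]. *)
Lemma power_series_remainder a (r : R) : 0 < r ->
  cvgn (series (fun j => a j * r ^+ j)) ->
  forall J, exists2 C, 0 <= C & forall u l, 0 <= u -> u <= r / 2 ->
    series (fun j => a j * u ^+ j) @ \oo --> l ->
    `|l - \sum_(j < J) a j * u ^+ j| <= C * u ^+ J.
Proof.
move=> r0 ca J.
have [M M0 HM] : exists2 M : R, 0 <= M & forall j, `|a j| * r ^+ j <= M.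
  have [M M0 HM] :=
    ex_strict_bound_gt0 (cvg_seq_bounded (cvgP _ (cvg_series_cvg_0 ca))).
  exists M; first exact: ltW.
  move=> j; have := HM j I; rewrite /= normrM normrX (gtr0_norm r0); exact: ltW.
exists (2 * M / r ^+ J); first by rewrite divr_ge0 ?mulr_ge0 // exprn_ge0 // ltW.
move=> u l u0 ur cl.
have t0 : 0 <= u / r by rewrite divr_ge0 // ltW.
have t2 : u / r <= 1 / 2 by rewrite ler_pdivrMr //; lra.
(* The telescoping bound is inductive because [2 t^(n+1) <= t^n] for [t = u / r <= 1 / 2]. *)
have step n : (J <= n)%N -> `|series (fun j => a j * u ^+ j) n
    - \sum_(j < J) a j * u ^+ j| <= M * (2 * (u / r) ^+ J - 2 * (u / r) ^+ n).
  elim: n => [|n IHn].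
    by rewrite leqn0 => /eqP ->; rewrite /series /= big_geq // big_ord0 !subrr normr0 mulr0.
  rewrite leq_eqVlt => /predU1P[->|Jn].
    by rewrite /series /= big_mkord !subrr normr0 mulr0.
  rewrite seriesSr addrAC (le_trans (ler_normD _ _)) //.
  have h1 := IHn Jn.
  have h2 : `|a n * u ^+ n| <= M * (u / r) ^+ n.
    rewrite normrM normrX (ger0_norm u0) expr_div_n [leRHS]mulrCA [leLHS]mulrC.
    by rewrite ler_wpM2l ?exprn_ge0 // ler_pdivlMr ?exprn_gt0.
  have h3 : 2 * (u / r) ^+ n.+1 <= (u / r) ^+ n.
    rewrite exprS mulrA ler_piMl ?exprn_ge0 //; lra.
  have h4 := ler_wpM2l M0 h3.
  by move: h1 h2 h4; lra.
have cvgS : (fun n => `|series (fun j => a j * u ^+ j) n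
    - \sum_(j < J) a j * u ^+ j|) @ \oo --> `|l - \sum_(j < J) a j * u ^+ j|.
  by apply: cvg_norm; apply: cvgB => //; exact: cvg_cst.
apply: (ler_cvg_to cvgS (cvg_cst _)).
near=> n; have Jn : (J <= n)%N by near: n; exact: nbhs_infty_ge.
apply: (le_trans (step n Jn)).
rewrite mulrBr [leRHS]mulrAC -mulrA expr_div_n.
have : 0 <= M * (2 * (u ^+ n / r ^+ n)).
  by rewrite !mulr_ge0 ?invr_ge0 ?exprn_ge0 // ltW.
by rewrite expr_div_n; lra.
Unshelve. all: by end_near.
Qed.

(** The difference series sums to 0, so its truncation at order [i + 1] is [O(u^(i+1))] and has
    vanishing coefficients. *)
Lemma power_series_unique a b (r : R) (l : R -> R) : 0 < r ->
  (forall u, `|u| < r -> series (fun j => a j * u ^+ j) @ \oo --> l u) ->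
  (forall u, `|u| < r -> series (fun j => b j * u ^+ j) @ \oo --> l u) ->
  a =1 b.
Proof.
move=> r0 Ha Hb i.
have Hc u : `|u| < r -> series (fun j => (a j - b j) * u ^+ j) @ \oo --> 0.
  move=> ur; rewrite -[X in _ --> X](subrr (l u)).
  rewrite (_ : series _ = series (fun j => a j * u ^+ j)
    \- series (fun j => b j * u ^+ j)); first by apply: cvgB; [exact: Ha|exact: Hb].
  apply/funext => n; rewrite /series /= -sumrB; apply: eq_bigr => j _.
  by rewrite mulrBl.
have r2 : 0 < r / 2 by rewrite divr_gt0.
have r2r : `|r / 2| < r by rewrite gtr0_norm //; lra.
have cc : cvgn (series (fun j => (a j - b j) * (r / 2) ^+ j)).
  by apply/cvg_ex; exists 0; exact: Hc.
have [C C0 HC] := power_series_remainder r2 cc i.+1.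
apply/eqP; rewrite -subr_eq0; apply/eqP.
have x0 : 0 < r / 4 by rewrite divr_gt0.
have := @poly_small_coef0 (\poly_(j < i.+1) (a j - b j)) (r / 4) C i.+1 0 x0.
move=> /(_ _ i (ltnSn i)); rewrite coef_poly ltnSn; apply => n _.
set u := r / 4 / n.+1%:R.
have u0 : 0 <= u by rewrite divr_ge0 ?ler0n // ltW.
have u4 : u <= r / 2 / 2.
  have n1 : 1 <= n.+1%:R :> R by rewrite ler1n.
  by rewrite /u ler_pdivrMr ?ltr0n //; nra.
have := HC u 0 u0 u4 (Hc u _); rewrite sub0r normrN horner_poly; apply.
by rewrite ger0_norm //; lra.
Qed.

Lemma power_series_poly p (u : R) :
  series (fun j => p`_j * u ^+ j) @ \oo --> p.[u].
Proof.
apply: cvg_near_cst; near=> n.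
have pn : (size p <= n)%N by near: n; exact: nbhs_infty_ge.
rewrite /series /= big_mkord (horner_coef_wide _ pn) //.
Unshelve. all: by end_near.
Qed.

(* Along [u = t e] the bound reads [O(e ^+ M)] for every [t] in [(0, 1]], so each
   coefficient in [e] is a polynomial in [t] vanishing on that interval. *)
Lemma poly2_small_coef0 (b : nat -> nat -> R) (K M n0 : nat) (x C eta : R) :
  0 < x -> 0 < eta ->
  (forall n u, (n0 <= n)%N -> 0 < u -> u < eta ->
    `|\sum_(j < K) \sum_(k < K) b j k * u ^+ j * (x / n.+1%:R) ^+ k|
      <= C * (u ^+ M + (x / n.+1%:R) ^+ M)) ->
  forall j k, (j < K)%N -> (k < K)%N -> (j + k < M)%N -> b j k = 0.
Proof.
move=> x0 eta0 Hb j0 k0 j0K k0K jkM.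
have [n1 Hn1] := div_succn_lt x eta0.
have C0 : 0 <= C.
  have := Hb (maxn n0 n1) (x / (maxn n0 n1).+1%:R) (leq_maxl _ _).
  have e0 : 0 < x / (maxn n0 n1).+1%:R by rewrite divr_gt0 // ltr0n.
  move=> /(_ e0 (Hn1 _ (leq_maxr _ _)))/(le_trans (normr_ge0 _)).
  by rewrite pmulr_lge0 // addr_gt0 // exprn_gt0.
(* The coefficient of [e^(j0 + k0)] after substituting [u = t e], as a polynomial in [t]; [b j0 k0]
   is its coefficient of [t^j0]. *)
pose s : {poly R} := \sum_(j < K) \sum_(k < K)
  (b j k * (j + k == j0 + k0)%N%:R) *: 'X^j.
have sE : s`_j0 = b j0 k0.
  rewrite coef_sum (bigD1 (Ordinal j0K)) //= coef_sum (bigD1 (Ordinal k0K)) //=.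
  rewrite coefZ coefXn !eqxx !mulr1 big1 ?addr0 => [|k kk]; last first.
    by rewrite coefZ eqn_add2l (_ : (k == k0 :> nat) = false) ?mulr0 ?mul0r //; apply/negbTE.
  rewrite big1 ?addr0 // => j jj; rewrite coef_sum big1 // => k _.
  rewrite coefZ coefXn (_ : (j0 == j :> nat) = false) ?mulr0 //.
  by apply/negbTE; rewrite eq_sym; exact: jj.
(* It suffices that [s] vanishes at the points [t = 1 / m.+1], hence the constant 0. *)
rewrite -sE; apply: (@poly_small_coef0 s 1 0 (j0 + 1) 0 ltr01); last by rewrite addn1.
move=> m _; rewrite mul0r; set t := 1 / m.+1%:R.
have t0 : 0 < t by rewrite divr_gt0 // ltr0n.
have t1 : t <= 1 by rewrite ler_pdivrMr ?ltr0n // mul1r ler1n.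
pose p : {poly R} := \sum_(j < K) \sum_(k < K) (b j k * t ^+ j) *: 'X^(j + k).
have -> : s.[t] = p`_(j0 + k0).
  rewrite /s /p horner_sum coef_sum; apply: eq_bigr => j _.
  rewrite horner_sum coef_sum; apply: eq_bigr => k _.
  by rewrite hornerZ hornerXn coefZ coefXn eq_sym mulrAC.
rewrite (@poly_small_coef0 p x (C * 2) M (maxn n0 n1)) ?normr0 //.
move=> n; rewrite geq_max => /andP[nn0 nn1]; set e := x / n.+1%:R.
have e0 : 0 < e by rewrite divr_gt0 // ltr0n.
have te0 : 0 < t * e by rewrite mulr_gt0.
have tee : t * e <= e by rewrite ler_piMl // ltW.
have := Hb n (t * e) nn0 te0 (le_lt_trans tee (Hn1 n nn1)).
rewrite -/e => h.
have -> : p.[e] = \sum_(j < K) \sum_(k < K) b j k * (t * e) ^+ j * e ^+ k.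
  rewrite /p horner_sum; apply: eq_bigr => j _; rewrite horner_sum.
  by apply: eq_bigr => k _; rewrite hornerZ hornerXn [(t * e) ^+ j]exprMn exprD !mulrA.
apply: (le_trans h); rewrite -mulrA ler_wpM2l // mulrDl mul1r lerD2r.
by rewrite lerXn2r ?nnegrE // ltW.
Qed.
End PowerSeries.

(** * Iterated summation of absolutely convergent double series *)

Section DoubleSeries.
Variables (R : realType) (a : nat -> nat -> R).

(** Summing [k] to infinity for [l < n] changes the square partial sum by at most the tail
    [limn A - A n] of the absolute sums, which tends to 0. *)
Lemma cvg_double_psum_iterated (s t f : R) (b : nat -> R) :
  cvgn (double_psum (fun k l => `|a k l|) `|s| `|t|) ->
  double_psum a s t @ \oo --> f ->
  (forall l, series (fun k => a k l * s ^+ k) @ \oo --> b l) ->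
  series (fun l => b l * t ^+ l) @ \oo --> f.
Proof.
move=> cA cf cb; set A := double_psum _ _ _ in cA.
pose rect m n : R := \sum_(k < m) \sum_(l < n) `|a k l| * `|s| ^+ k * `|t| ^+ l.
have term0 k l : 0 <= `|a k l| * `|s| ^+ k * `|t| ^+ l.
  by rewrite !mulr_ge0 ?exprn_ge0.
have rect_le m n n' : (n <= n')%N -> rect m n <= rect m n'.
  move=> nn'; apply: ler_sum => k _; rewrite -!(big_mkord xpredT (fun l => `|a k l| * `|s| ^+ k * `|t| ^+ l)).
  by rewrite [leRHS](big_cat_nat (leq0n n) nn') /= lerDl sumr_ge0.
have A_ndecr : nondecreasing_seq A.
  apply/nondecreasing_seqP => n; rewrite /A /double_psum -/(rect n n) -/(rect n.+1 n.+1).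
  apply: le_trans (rect_le _ n n.+1 (leqnSn n)) _.
  by rewrite /rect [leRHS]big_ord_recr /= lerDl sumr_ge0.
have A_le n : A n <= limn A by apply: nondecreasing_cvgn_le.
pose D n m : R := \sum_(l < n) (\sum_(k < m) a k l * s ^+ k) * t ^+ l.
have D_diff n m : (n <= m)%N -> `|D n m - D n n| <= rect m n - rect n n.
  elim: m => [|m IHm]; first by rewrite leqn0 => /eqP ->; rewrite !subrr normr0.
  rewrite leq_eqVlt => /predU1P[->|nm]; first by rewrite !subrr normr0.
  have -> : D n m.+1 = D n m + \sum_(l < n) a m l * s ^+ m * t ^+ l.
    rewrite /D -big_split /=; apply: eq_bigr => l _.
    by rewrite big_ord_recr /= mulrDl.
  have -> : rect m.+1 n = rect m n + \sum_(l < n) `|a m l| * `|s| ^+ m * `|t| ^+ l.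
    by rewrite /rect big_ord_recr.
  rewrite addrAC [leRHS]addrAC (le_trans (ler_normD _ _)) // lerD ?IHm //.
  rewrite (le_trans (ler_norm_sum _ _ _)) //; apply: ler_sum => l _.
  by rewrite !normrM !normrX.
have D_cvg n : D n m @[m --> \oo] --> series (fun l => b l * t ^+ l) n.
  rewrite /series /= big_mkord.
  apply: (cvg_big (op := +%R)) => [|l _]; first exact: add_continuous.
  apply: cvgM; last exact: cvg_cst.
  by have := cb l; rewrite /series /=; under eq_fun do rewrite big_mkord.
have bound n : `|series (fun l => b l * t ^+ l) n - double_psum a s t n|
    <= limn A - A n.
  have <- : D n n = double_psum a s t n.
    rewrite /D /double_psum exchange_big /=; apply: eq_bigr => l _.
    by rewrite mulr_suml.
  have cD : `|D n m - D n n| @[m --> \oo] -->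
      `|series (fun l => b l * t ^+ l) n - D n n|.
    by apply: cvg_norm; apply: cvgB => //; exact: cvg_cst.
  apply: (ler_cvg_to cD (cvg_cst _)); near=> m.
  have nm : (n <= m)%N by near: m; exact: nbhs_infty_ge.
  apply: le_trans (D_diff n m nm) _; rewrite lerD2r.
  by apply: le_trans (A_le m); exact: rect_le.
have d0 : (series (fun l => b l * t ^+ l) n - double_psum a s t n)
    @[n --> \oo] --> 0.
  apply: norm_cvg0; apply: (@squeeze_cvgr _ _ _ _ (fun=> 0) (fun n => limn A - A n)).
  - by near=> n; rewrite normr_ge0 bound.
  - exact: cvg_cst.
  - by rewrite -[X in _ --> X](subrr (limn A)); apply: cvgB => //; exact: cvg_cst.
rewrite -[f]add0r.
have -> : series (fun l => b l * t ^+ l) =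
    (fun n => series (fun l => b l * t ^+ l) n - double_psum a s t n)
    \+ double_psum a s t.
  by apply/funext => n /=; rewrite subrK.
exact: cvgD.
Unshelve. all: by end_near.
Qed.

(** The absolute sums for fixed [l], times [|t|^l], are part of the bounded absolute double sums. *)
Lemma cvg_double_psum_row (s t : R) l : t != 0 ->
  cvgn (double_psum (fun k l => `|a k l|) `|s| `|t|) ->
  cvgn (series (fun k => a k l * s ^+ k)).
Proof.
move=> t0 /cvg_seq_bounded/ex_strict_bound_gt0[M M0 HM].
have tl : 0 < `|t| ^+ l by rewrite exprn_gt0 // normr_gt0.
apply: normed_cvg; apply: nondecreasing_is_cvgn.
  by apply/nondecreasing_seqP => n; rewrite /= [leRHS]big_nat_recr //= lerDl.
exists (M / `|t| ^+ l) => _ [n _ <-]; rewrite ler_pdivlMr //.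
(* A square of side [n + l + 1] contains the index [l] together with all [k < n]. *)
have := HM (n + l.+1)%N I => /ltW /=; apply: le_trans.
rewrite (le_trans _ (ler_norm _)) // /series /= big_mkord mulr_suml.
rewrite /double_psum big_split_ord /= ler_wpDr //.
  by apply: sumr_ge0 => k _; apply: sumr_ge0 => j _; rewrite !mulr_ge0 ?exprn_ge0.
apply: ler_sum => k _.
have ln : (l < n + l.+1)%N by rewrite addnS ltnS leq_addl.
rewrite (bigD1 (Ordinal ln)) //= normrM normrX lerDl.
by apply: sumr_ge0 => j _; rewrite !mulr_ge0 ?exprn_ge0.
Qed.
End DoubleSeries.

(** * Comparison of the two expansions *)

(** Summing the double series over powers of [x - x0] first gives a second power series in [u] with
    sum [f x u]; uniqueness identifies its coefficients with [beta j x]. *)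
Lemma analytic_coef_power_series (R : realType) (f : R -> R -> R) (x0 d : R)
    (beta : nat -> R -> R) : 0 < d -> analytic_on_box f x0 0 d ->
  (forall x u, `|x - x0| < d -> `|u| < d ->
     series (fun j => beta j x * u ^+ j) @ \oo --> f x u) ->
  exists a : nat -> nat -> R, forall j x, `|x - x0| < d ->
    series (fun k => a j k * (x - x0) ^+ k) @ \oo --> beta j x.
Proof.
move=> d0 [a Ha] Hb; exists (fun j k => a k j) => j x xd.
have d2 : `|d / 2| < d by rewrite gtr0_norm ?divr_gt0 //; lra.
have row l : cvgn (series (fun k => a k l * (x - x0) ^+ k)).
  apply: (@cvg_double_psum_row _ _ _ (d / 2)); first by rewrite gt_eqF ?divr_gt0.
  by have := Ha x (d / 2) xd; rewrite subr0 => /(_ d2) [].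
pose b l := limn (series (fun k => a k l * (x - x0) ^+ k)).
have -> : beta j x = b j.
  apply: (power_series_unique d0 (fun u => Hb x u xd)) => u ud.
  have := Ha x u xd; rewrite subr0 => /(_ ud) [cA cf].
  exact: cvg_double_psum_iterated cA cf row.
exact: row.
Qed.

Lemma pos_lower_bound (R : realDomainType) (delta : nat -> R) (G : nat) :
  (forall g, 0 < delta g) ->
  exists2 rho, 0 < rho & forall g, (g < G)%N -> rho <= delta g.
Proof.
move=> d0; elim: G => [|G [rho rho0 IH]]; first by exists 1.
exists (Num.min rho (delta G)); first by rewrite lt_min rho0 d0.
move=> g; rewrite ltnS leq_eqVlt => /predU1P[->|/IH h].
  by rewrite ge_min lexx orbT.
by rewrite ge_min h.
Qed.

(** Add the [G] power series remainders; [e <= 1] makes the bound uniform in [e]. *)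
Lemma expansion_truncation (R : realType) (rr : nat -> R -> R)
    (beta : nat -> nat -> R) (delta : nat -> R) (G J : nat) :
  (forall g, 0 < delta g) ->
  (forall g u, (g < G)%N -> `|u| < delta g ->
     series (fun j => beta g j * u ^+ j) @ \oo --> rr g u) ->
  exists C eta, 0 < eta /\ forall u e, 0 < u -> u < eta -> 0 <= e -> e <= 1 ->
    `|\sum_(g < G) rr g u * e ^+ (2 * g)
      - \sum_(g < G) (\sum_(j < J) beta g j * u ^+ j) * e ^+ (2 * g)|
    <= C * u ^+ J.
Proof.
move=> d0; elim: G => [|G IHG] Hb.
  by exists 0, 1; split => // u e _ _ _ _; rewrite !big_ord0 subrr normr0 mul0r.
have [g u gG|C [eta [eta0 IH]]] := IHG; first exact/Hb/ltnW.
have dG := d0 G; have dG2 : 0 < delta G / 2 by rewrite divr_gt0.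
have HG u : `|u| < delta G -> series (fun j => beta G j * u ^+ j) @ \oo --> rr G u.
  exact: Hb.
have cG : cvgn (series (fun j => beta G j * (delta G / 2) ^+ j)).
  by apply/cvg_ex; exists (rr G (delta G / 2)); apply: HG; rewrite gtr0_norm //; lra.
have [C' C'0 HC'] := power_series_remainder dG2 cG J.
exists (C + C'), (Num.min eta (delta G / 2 / 2)).
split=> [|u e u0]; first by rewrite lt_min eta0 divr_gt0.
rewrite lt_min => /andP[ue ud] e0 e1.
rewrite !big_ord_recr /= opprD addrACA mulrDl (le_trans (ler_normD _ _)) //.
rewrite lerD ?IH // -mulrBl normrM.
rewrite -[leRHS]mulr1 ler_pM //; last first.
  by rewrite normrX exprn_ile1 // ger0_norm.
apply: HC'; [exact: ltW|exact: ltW|apply: HG].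
by rewrite gtr0_norm //; lra.
Qed.

(** Recasts the truncated expansion as a square array in [u] and [e], zero at odd powers of [e], the
    form in which it is compared with [Q_J]. *)
Lemma expansion_sumE (R : realType) (b : nat -> nat -> R) (u e : R)
    (G M L : nat) : (2 * G <= L)%N -> (M <= L)%N ->
  \sum_(g < G) (\sum_(j < M) b g j * u ^+ j) * e ^+ (2 * g) =
  \sum_(j < L) \sum_(k < L) (\sum_(g < G)
    (if (k == 2 * g :> nat)%N && (j < M)%N then b g j else 0)) * u ^+ j * e ^+ k.
Proof.
move=> GL ML.
under [RHS]eq_bigr do under eq_bigr do rewrite -mulrA mulr_suml.
under [RHS]eq_bigr do rewrite exchange_big /=.
rewrite [RHS]exchange_big /=; apply: eq_bigr => g _.
have gL : (2 * g < L)%N by apply: leq_trans GL; rewrite ltn_pmul2l.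
rewrite mulr_suml (big_ord_widen L (fun j => b g j * u ^+ j * e ^+ (2 * g))) //.
rewrite big_mkcond; apply: eq_bigr => j _.
rewrite (bigD1 (Ordinal gL)) //= eqxx big1 ?addr0 => [|k kk]; last first.
  by rewrite (_ : (k == 2 * g :> nat)%N = false) ?mul0r //; exact/negbTE.
by case: ifP; rewrite ?mul0r ?mulrA.
Qed.

Lemma expansion_coefE (R : realType) (b : nat -> nat -> R) (G M g j : nat) :
  (g < G)%N -> (j < M)%N ->
  \sum_(i < G) (if (2 * g == 2 * i)%N && (j < M)%N then b i j else 0) = b g j.
Proof.
move=> gG jM; rewrite (bigD1 (Ordinal gG)) //= eqxx jM /= big1 ?addr0 // => i ig.
by rewrite eqn_mul2l /= eq_sym (_ : (i == g :> nat) = false) //; exact/negbTE.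
Qed.

Lemma three_term_bound (R : realDomainType) (C1 C2 C3 S1 S2 A Q y z : R) :
  0 <= y -> 0 <= z -> `|S1 - S2| <= C3 * y -> `|A - S1| <= C1 * z ->
  `|A - Q| <= C2 * y -> `|S2 - Q| <= (`|C1| + `|C2| + `|C3|) * (y + z).
Proof.
move=> y0 z0 h3 h1 h2.
have -> : S2 - Q = - (S1 - S2) - (A - S1) + (A - Q) by ring.
rewrite (le_trans (ler_normD _ _)) //.
apply: (@le_trans _ _ (C3 * y + C1 * z + C2 * y)).
  by rewrite lerD // (le_trans (ler_normD _ _)) // !normrN lerD.
have := ler_wpM2r y0 (ler_norm C3); have := ler_wpM2r y0 (ler_norm C2).
have := ler_wpM2r z0 (ler_norm C1).
have := mulr_ge0 (normr_ge0 C1) y0; have := mulr_ge0 (normr_ge0 C2) z0.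
have := mulr_ge0 (normr_ge0 C3) z0; lra.
Qed.

(** At fixed [x], the truncated topological expansion and [Q_M] both approximate [a N u n] up to
    [O(u^M + e^M)], so their low-order coefficients agree. The radius [rho] depends on [j] through
    the truncation orders. *)
Lemma string_coef_near_one (R : realType) (nu : nat) (a : R -> R -> nat -> R)
    (rr : nat -> R -> R -> R) (delta : nat -> R) (beta : nat -> nat -> R -> R) :
  (0 < nu)%N ->
  (forall N u n, 0 < N -> 0 < u -> (2 * nu <= n)%N ->
    n%:R / N = a N u n + u * path_sum (a N u) (2 * nu).-1 nu n) ->
  (forall g, 0 < delta g) ->
  topological_expansion a rr ->
  (forall g x u, `|x - 1| < delta g -> `|u| < delta g ->
     series (fun j => beta g j x * u ^+ j) @ \oo --> rr g x u) ->
  forall g j, exists c rho : R, 0 < rho /\ forall x, `|x - 1| < rho ->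
    beta g j x =
      if (2 * g <= j * nu.-1 + 1)%N then c * x ^+ (j * nu.-1 + 1 - 2 * g) else 0.
Proof.
move=> nu0 string d0 hexp hb g j.
(* [M = 2 G] matches the error [N^(-2G)] with [e^M], and [j + 2 g < M] puts the wanted coefficient
   below the error. *)
have [G [M [ME gG jM jgM]]] : exists G M,
    [/\ M = (2 * G)%N, (g < G)%N, (j < M)%N & (j + 2 * g < M)%N].
  by exists (g + j).+1, (2 * (g + j).+1)%N; split; lia.
have a_bounded : exists eta C N0 : R, [/\ 0 < eta, 0 < N0 &
  forall (N u : R) (n : nat), N0 < N -> (0 < n)%N -> `|n%:R / N - 1| < eta ->
    0 < u < eta -> `|a N u n| <= C].
  have [eta [C [N0 [eta0 N00 H]]]] := hexp 0%N.
  exists eta, C, N0; split => // N u n hN n0 hn hu.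
  by have := H N u n hN n0 hn hu; rewrite big_ord0 subr0 muln0 expr0 invr1 mulr1.
have [eta1 [C1 [N1 [eta10 N10 H1]]]] := hexp G.
have [eta2 [C2 [N2 [eta20 N20 H2]]]] := string_iter_approx nu0 string a_bounded M.
have N12 : 0 < (N1 + N2 + 1)^-1 by rewrite invr_gt0 !addr_gt0.
have [rho rho0 Hrho] := pos_lower_bound G d0.
have [q [K HQ]] := whomog_normal_form (@whomog_string_iter R _ nu0 M).
exists (q j (2 * g)%N), (Num.min (Num.min eta1 eta2) (Num.min rho (1 / 2))).
split=> [|x]; first by rewrite !lt_min eta10 eta20 rho0 divr_gt0.
rewrite !lt_min => /andP[/andP[x1 x2] /andP[xr xh]].
have x0 : 0 < x by move: xh; rewrite ltr_norml => /andP[xh _]; lra.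
have [C3 [eta3 [eta30 H3]]] := @expansion_truncation R (fun g u => rr g x u)
  (fun g j => beta g j x) delta G M d0
  (fun g u gG ud => hb g x u (lt_le_trans xr (Hrho g gG)) ud).
pose b1 j k : R := \sum_(g < G)
  (if (k == 2 * g)%N && (j < M)%N then beta g j x else 0).
pose b2 j k : R :=
  if (k <= j * nu.-1 + 1)%N then q j k * x ^+ (j * nu.-1 + 1 - k) else 0.
pose L := (K + M)%N.
have ML : (M <= L)%N by exact: leq_addl.
have gL : (2 * g < L)%N by apply: leq_trans ML; apply: leq_ltn_trans jgM; exact: leq_addl.
have jL : (j < L)%N by exact: leq_trans ML.
have b1E : b1 j (2 * g)%N = beta g j x.
  exact: (expansion_coefE (fun g j => beta g j x)).
suff : b1 j (2 * g)%N - b2 j (2 * g)%N = 0.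
  by move/eqP; rewrite subr_eq0 b1E => /eqP.
have [n1 Hn1] := div_succn_lt x N12.
pose eta := Num.min (Num.min eta1 eta2) eta3.
have eta_gt0 : 0 < eta by rewrite !lt_min eta10 eta20 eta30.
apply: (@poly2_small_coef0 R (fun j k => b1 j k - b2 j k) L M n1 x
  (`|C1| + `|C2| + `|C3|) eta) => // n u nn u0.
rewrite !lt_min => /andP[/andP[u1 u2] u3].
(* [N] is real, so it can be chosen to make the ratio [n.+1 / N] exactly [x]. *)
have [N NE] : exists N : R, N = n.+1%:R / x by eexists.
have N0 : 0 < N by rewrite NE divr_gt0 // ltr0n.
have eE : x / n.+1%:R = N^-1 by rewrite NE invf_div.
have xE : n.+1%:R / N = x by rewrite NE invf_div mulrC divfK // pnatr_eq0.
have e0 : 0 < N^-1 by rewrite invr_gt0.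
have NN : N1 + N2 + 1 < N.
  have := Hn1 n nn; rewrite eE ltf_pV2 // posrE; lra.
have e1 : N^-1 <= 1 by rewrite invf_le1 //; lra.
rewrite eE.
have -> : \sum_(j < L) \sum_(k < L) (b1 j k - b2 j k) * u ^+ j * N^-1 ^+ k =
    \sum_(g < G) (\sum_(j < M) beta g j x * u ^+ j) * N^-1 ^+ (2 * g)
    - string_iter nu M x N^-1 u.
  rewrite (HQ L) ?leq_addr //.
  under eq_bigr do under eq_bigr do rewrite mulrBl mulrBl.
  under eq_bigr do rewrite sumrB.
  rewrite sumrB; congr (_ - _).
  by rewrite (expansion_sumE (fun g j => beta g j x) _ _ (L := L)) // -ME.
have h3 := H3 u N^-1 u0 u3 (ltW e0) e1.
have h1 := H1 N u n.+1 (ltac:(lra)) isT (ltac:(by rewrite xE)) (ltac:(by rewrite u0)).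
have h2 := H2 N u n.+1 (ltac:(lra)) isT (ltac:(by rewrite xE)) (ltac:(by rewrite u0)).
move: h1 h2 h3; rewrite xE -ME.
under eq_bigr do rewrite -exprVn.
rewrite -exprVn.
set S1 := \sum_(g < G) _; set S2 := \sum_(g < G) _; set A := a _ _ _.
set Q := string_iter _ _ _ _ _ => h1 h2 h3.
have uM : 0 <= u ^+ M by rewrite exprn_ge0 // ltW.
have eM : 0 <= N^-1 ^+ M by rewrite exprn_ge0 // ltW.
exact: (three_term_bound uM eM h3 h1 h2).
Qed.

(** [c x^D] is a polynomial in [x - 1]; agreement near 1 forces the coefficients [a] to be those of
    this polynomial, so the sums agree wherever the series is known to converge to [f]. *)
Lemma power_series_monomial_extension (R : realType) (f : R -> R) (a : nat -> R)
    (d rho c : R) (D : nat) : 0 < d -> 0 < rho ->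
  (forall x, `|x - 1| < d ->
     series (fun k => a k * (x - 1) ^+ k) @ \oo --> f x) ->
  (forall x, `|x - 1| < rho -> f x = c * x ^+ D) ->
  forall x, `|x - 1| < d -> f x = c * x ^+ D.
Proof.
move=> d0 rho0 Ha Hf x xd.
pose p : {poly R} := c *: ('X + 1%:P) ^+ D.
have pE y : p.[y - 1] = c * y ^+ D.
  by rewrite /p hornerZ horner_exp hornerD hornerX hornerC subrK.
have r0 : 0 < Num.min d rho by rewrite lt_min d0 rho0.
have ap : a =1 (fun k => p`_k).
  apply: (power_series_unique (l := fun s => p.[s]) r0) => s.
    rewrite lt_min => /andP[sd sr]; have := Ha (s + 1); rewrite addrK => /(_ sd).
    by rewrite Hf ?addrK // -pE addrK.
  by move=> _; exact: power_series_poly.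
rewrite -pE; apply: (cvg_unique _ (Ha x xd)) => //.
rewrite (funext ap).
exact: power_series_poly.
Qed.

Lemma scaling_exponentE (nu g j : nat) : (0 < nu)%N ->
  scaling_exponent nu g j = (j * nu.-1 + 1)%:Z - (2 * g)%:Z.
Proof. by rewrite /scaling_exponent; case: nu => // m _; lia. Qed.

Theorem theorem2p1 (R : realType) (nu : nat) (hnu : (1 <= nu)%N)
    (P : R -> R -> nat -> {poly R}) (h Rc : R -> R -> nat -> R)
    (hP : forall N u : R, 0 < N -> 0 < u ->
       monic_orthogonal (weight nu N u) (P N u) (h N u))
    (hrec : forall N u : R, 0 < N -> 0 < u ->
       three_term_recurrence (P N u) (Rc N u))
    (hRc : forall (N u : R) (n : nat), 0 < N -> 0 < u -> (0 < n)%N ->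
       Rc N u n = h N u n / h N u n.-1)
    (rr : nat -> R -> R -> R) (delta : nat -> R)
    (hdelta : forall g : nat, 0 < delta g)
    (han : forall g : nat, analytic_on_box (rr g) 1 0 (delta g))
    (hexp : topological_expansion Rc rr)
    (beta : nat -> nat -> R -> R)
    (hbeta : forall (g : nat) (x u : R),
       `|x - 1| < delta g -> `|u| < delta g ->
       series (fun j : nat => beta g j x * u ^+ j) @ \oo --> rr g x u) :
  forall g j : nat, exists c : R,
    (forall x : R, `|x - 1| < delta g ->
       beta g j x = c * x ^ (scaling_exponent nu g j)) /\
    (scaling_exponent nu g j < 0 ->
       c = 0 /\ forall x : R, `|x - 1| < delta g -> beta g j x = 0).
Proof.
move=> g j.
have string N u n (N0 : 0 < N) (u0 : 0 < u) : (2 * nu <= n)%N ->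
    n%:R / N = Rc N u n + u * path_sum (Rc N u) (2 * nu).-1 nu n.
  exact: (weight_string_equation hnu N0 u0 (hP N u N0 u0) (hrec N u N0 u0)).
have [c0 [rho [rho0 near1]]] :=
  string_coef_near_one hnu string hdelta hexp hbeta g j.
have [a Ha] := analytic_coef_power_series (hdelta g) (han g) (hbeta g).
pose D := (j * nu.-1 + 1 - 2 * g)%N.
have [Dge|Dlt] := leqP (2 * g) (j * nu.-1 + 1).
  have expD : scaling_exponent nu g j = D%:Z by rewrite scaling_exponentE // subzn.
  exists c0; split; last by rewrite expD.
  rewrite expD; apply: (power_series_monomial_extension (hdelta g) rho0 (Ha j)).
  by move=> x xr; rewrite near1 // Dge.
(* For a negative exponent the same extension is used with constant 0; [D] is then 0 by truncated
   subtraction. *)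
have beta0 x : `|x - 1| < delta g -> beta g j x = 0.
  move=> xd; rewrite -(mul0r (x ^+ D)).
  apply: (power_series_monomial_extension (hdelta g) rho0 (Ha j)) => // y yr.
  by rewrite near1 // leqNgt Dlt mul0r.
by exists 0; split=> [x /beta0 ->|_]; rewrite ?mul0r.
Qed.
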